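(* Let $G$ be a finitely generated group and let $\{B_n\}_{n\ge1}$ be the sequence of balls with respect to some finite symmetric generating set. Suppose that no infinite subsequence $\{B_{n(i)}\}_{i=1}^\infty$ of balls is Besicovitch. Then the ratio ergodic theorem fails along every subsequence $F_i=B_{n(i)}$, $i=1,2,\ldots$
   Context: For $A,B\subseteq G$ write $AB=\{ab : a\in A, b\in B\}$. The ball $B_n$ with respect to a finite symmetric generating set $A$ of $G$ is the set of elements that are products of at most $n$ elements of $A$ (i.e. $B_n=(A\cup\{1_G\})^n$). Besicovitch: a sequence $\{F_n\}$ of finite subsets of $G$ is Besicovitch if there is a constant $C$ such that for every finite $A\subseteq G$ and every family $\{F_{n(g)}g\}_{g\in A}$ there is a subset $A'\subseteq A$ with $1_A\le \sum_{g\in A'}1_{F_{n(g)}g}\le C$ pointwise on $G$. Ratio ergodic theorem: let $G$ act from the left by measure-preserving transformations $x\mapsto T^g x$. For finite $F\subseteq G$ put $S_F(\varphi)=\sum_{g\in F}\varphi\circ T^g$ and $R_F(\varphi,\psi)=S_F(\varphi)/S_F(\psi)$ (where the denominator is nonzero). The ratio ergodic theorem holds along $\{F_n\}$ if for every ergodic measure-preserving action of $G$ on a non-atomic $\sigma$-finite measure space $(X,\mathcal{B},\mu)$ and all $\varphi,\psi\in L^1(\mu)$ with $\int\psi\,d\mu\ne 0$, we have $R_{F_n}(\varphi,\psi)\to \int\varphi\,d\mu/\int\psi\,d\mu$ $\mu$-a.e.; it fails along $\{F_n\}$ if it does not hold. *)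

(* Defs.v *)
From HB Require Import structures.
From mathcomp Require Import all_boot all_order all_algebra.
From mathcomp Require Import finmap.
From mathcomp Require Import all_classical all_reals all_analysis.

Set Implicit Arguments.
Unset Strict Implicit.
Unset Printing Implicit Defensive.

Import Order.TTheory GRing.Theory Num.Theory.
Import numFieldNormedType.Exports.

Local Open Scope classical_set_scope.
Local Open Scope ring_scope.

(* G is a possibly infinite group, written multiplicatively in group scope. *)
Definition fset_mul (G : groupType) (A B : {fset G}) : {fset G} :=
  [fset (a * b)%g | a in A, b in B]%fset.

Definition fset_translate (G : groupType) (F : {fset G}) (g : G) : {fset G} :=
  [fset (f * g)%g | f in F]%fset.

Definition symmetric_fset (G : groupType) (A : {fset G}) : Prop :=
  forall a, a \in A -> (a^-1)%g \in A.

Definition generates (G : groupType) (A : {fset G}) : Prop :=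
  forall H : {pred G}, group_closed H -> {subset A <= H} -> forall g, g \in H.

Definition word_ball (G : groupType) (A : {fset G}) (n : nat) : {fset G} :=
  iter n (fset_mul (1%g |` A)%fset) [fset 1%g]%fset.

(* The indicator functions are booleans coerced to nat.  The family           *)
(* {F_{m(g)} g}_{g in A} is given by a total index function m : G -> nat, only *)
(* whose values on A are used.                                                *)
Definition besicovitch (G : groupType) (F : nat -> {fset G}) : Prop :=
  exists C : nat, forall (A : {fset G}) (m : G -> nat),
    exists2 A' : {fset G}, (A' `<=` A)%fset &
      forall h : G,
        ((h \in A) <= \sum_(g <- A') (h \in fset_translate (F (m g)) g) <= C)%N.

(* Subsequences of a sequence indexed from 1. *)
Definition subsequence_index (n : nat -> nat) : Prop :=
  (0 < n 0)%N /\ {homo n : i j / (i < j)%N}.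

Record measure_preserving_action (R : realType) (G : groupType)
    (d : measure_display) (X : measurableType d)
    (mu : {measure set X -> \bar R}) (T : G -> X -> X) : Prop := {
  action_one : forall x, T 1%g x = x;
  action_mul : forall g h x, T (g * h)%g x = T g (T h x);
  action_measurable : forall g, measurable_fun [set: X] (T g);
  action_preserving : forall g (A : set X),
    measurable A -> mu (T g @^-1` A) = mu A }.

Definition ergodic (R : realType) (G : groupType)
    (d : measure_display) (X : measurableType d)
    (mu : {measure set X -> \bar R}) (T : G -> X -> X) : Prop :=
  forall A : set X, measurable A -> (forall g, T g @^-1` A = A) ->
    mu A = 0%E \/ mu (~` A) = 0%E.

Definition atom (R : realType) (d : measure_display) (X : measurableType d)
    (mu : {measure set X -> \bar R}) (A : set X) : Prop :=
  [/\ measurable A, (0 < mu A)%E &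
    forall B, measurable B -> B `<=` A -> mu B = 0%E \/ mu (A `\` B) = 0%E].

Definition non_atomic (R : realType) (d : measure_display)
    (X : measurableType d) (mu : {measure set X -> \bar R}) : Prop :=
  forall A : set X, ~ atom mu A.

Definition orbit_sum (R : realType) (G : groupType) (X : Type)
    (T : G -> X -> X) (F : {fset G}) (phi : X -> R) (x : X) : R :=
  \sum_(g <- F) phi (T g x).

Definition orbit_ratio (R : realType) (G : groupType) (X : Type)
    (T : G -> X -> X) (F : {fset G}) (phi psi : X -> R) (x : X) : R :=
  orbit_sum T F phi x / orbit_sum T F psi x.

(* The ratio is only defined where its denominator is nonzero, so the limit is *)
(* taken along the indices n at which it is; the junk value a / 0 = 0 is never *)
(* used.                                                                       *)
Definition ratio_ergodic_theorem (R : realType) (G : groupType)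
    (F : nat -> {fset G}) : Prop :=
  forall (d : measure_display) (X : measurableType d)
    (mu : {sigma_finite_measure set X -> \bar R}) (T : G -> X -> X),
  measure_preserving_action mu T -> ergodic mu T -> non_atomic mu ->
  forall phi psi : X -> R,
  mu.-integrable [set: X] (EFin \o phi) ->
  mu.-integrable [set: X] (EFin \o psi) ->
  \int[mu]_x psi x != 0 ->
  {ae mu, forall x,
    orbit_ratio T (F n) phi psi x
      @[n --> within [set n | orbit_sum T (F n) psi x != 0] \oo]
      --> \int[mu]_x phi x / \int[mu]_x psi x}.

(* Main.v *)
Require Import Defs.
From HB Require Import structures.
From mathcomp Require Import all_boot all_order all_algebra.
From mathcomp Require Import finmap zify ring lra.
From mathcomp Require Import all_classical all_reals all_analysis.
From mathcomp Require Import measurable_realfun.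

(** One action is built along which the ratios oscillate.

Combinatorics of balls.  Selecting centres by decreasing radius, one sees that
if the balls of radii [n i + k] are not Besicovitch then arbitrarily many of
them share a point although none contains the centre of another
([crowded_point]).  A pigeonhole argument turns this into [sparse_cuts]: there
are many elements [c], each lying in a ball of radius [n i - k], whose
quotients [c' * c^-1] lie outside the ball of radius [n i + k].  The slack [k]
makes this stable under thickening: when a finite set [F] is small compared
with [k], the ball of radius [n i] about any point of [F * c] contains all of
[F] but meets no [F * c'] with [c' != c].

Dynamics.  These configurations are the steps of a cutting and stacking
construction, that is, of a rank-one action.  The cells of stage [N] are
intervals of one length labelled by a finite set [F] of group elements; each is
cut into one slice per element of [C], the slice [c] of the cell [f] receives
the label [f * c], and new cells are added.  The element [g] translates the cell
labelled [f] onto the cell labelled [g * f].  Being piecewise a translation,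
this action preserves Lebesgue measure, restricted to the union of all cells.
An invariant set has the same mass in all cells of one stage, so its density
is the same in every half-line and hence in every Borel set; taking its
complement as that Borel set gives ergodicity ([transport_ergodic]).

Counting.  Let [U] be the unit interval, itself a cell of stage [0], and [D] the
labels of the cells of stage [N] that make it up.  The bait consists, for every
[N], of the cells of stage [N.+1] labelled by [D].  A point of [U] has at stage
[N.+1] a label [f * c] with [f] in [D].  The ball of radius [n i] belonging to
[c] moves it to all labels in [D], which are bait, but within [U] only to the
slices [D * c] ([erratic_orbit]).  So the ratio of visits to the bait and to [U]
is at least [1] at arbitrarily late times, whereas the bait, whose measure is at
most the sum of the [1 / size C] over all stages, has at most half the measure
of [U]. *)

Set Implicit Arguments.
Unset Strict Implicit.
Unset Printing Implicit Defensive.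

Import Order.TTheory GRing.Theory Num.Theory.
Import numFieldNormedType.Exports.

(** * Word balls *)

Section WordBalls.
Variables (G : groupType) (A : {fset G}).
Local Notation B := (word_ball A).
Local Open Scope group_scope.

Lemma mem_fset_translate (F : {fset G}) (g h : G) :
  (h \in fset_translate F g) = (h * g^-1 \in F).
Proof.
apply/imfsetP/idP => [[f /= fF ->]|hF]; first by rewrite mulgK.
by exists (h * g^-1); rewrite ?mulgVK.
Qed.

Lemma mem_word_ballS n g :
  reflect (exists a b, [/\ a \in (1 |` A)%fset, b \in B n & g = a * b])
    (g \in B n.+1).
Proof.
rewrite /word_ball iterS; apply: (iffP idP) => [|[a [b [aA bB ->]]]].
  by move=> /imfset2P[a aA [b bB ->]]; exists a, b.
by apply/imfset2P; exists a => //; exists b.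
Qed.

Lemma mem1_word_ball n : 1 \in B n.
Proof.
elim: n => [|n IHn]; first by rewrite /word_ball /= inE.
by apply/mem_word_ballS; exists 1, 1; rewrite mul1g !inE eqxx.
Qed.

Lemma word_ballM m n g h : g \in B m -> h \in B n -> g * h \in B (m + n).
Proof.
elim: m g => [|m IHm] g.
  by rewrite /word_ball /= inE => /eqP-> hB; rewrite mul1g.
move=> /mem_word_ballS[a [b [aA bB ->]]] hB; rewrite addSn -mulgA.
by apply/mem_word_ballS; exists a, (b * h); split=> //; exact: IHm.
Qed.

Lemma word_ball_split m n g :
  g \in B (m + n) -> exists a b, [/\ a \in B m, b \in B n & g = a * b].
Proof.
elim: m g => [|m IHm] g.
  by move=> gB; exists 1, g; rewrite mul1g mem1_word_ball.
rewrite addSn => /mem_word_ballS[a [b [aA /IHm[c [d [cB dB ->]]] ->]]].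
exists (a * c), d; split=> //; last by rewrite mulgA.
by apply/mem_word_ballS; exists a, c.
Qed.

Lemma sub_word_ball m n g : m <= n -> g \in B m -> g \in B n.
Proof.
move=> le_mn gB; rewrite -(subnKC le_mn) -[g]mulg1.
by rewrite word_ballM ?mem1_word_ball.
Qed.

Hypothesis symA : symmetric_fset A.

Lemma word_ballV n g : g \in B n -> g^-1 \in B n.
Proof.
elim: n g => [|n IHn] g.
  by rewrite /word_ball /= !inE => /eqP->; rewrite invg1.
move=> /mem_word_ballS[a [b [aA bB ->]]]; rewrite invgM -addn1.
apply: word_ballM; first exact: IHn.
apply/mem_word_ballS; exists a^-1, 1; rewrite mulg1 mem1_word_ball; split=> //.
move: aA; rewrite !inE => /orP[/eqP->|aA]; first by rewrite invg1 eqxx.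
by rewrite symA ?orbT.
Qed.

Lemma word_ball_divC n g h : (g * h^-1 \in B n) = (h * g^-1 \in B n).
Proof. by apply/idP/idP => /word_ballV; rewrite invgM invgK. Qed.

Lemma word_ball_exhaust : generates A -> forall g, exists n, g \in B n.
Proof.
move=> genA g; pose H := [pred g | `[< exists n, g \in B n >]].
suff: g \in H by move=> /asboolP.
apply: genA => [|a aA]; last first.
  apply/asboolP; exists 1%N; apply/mem_word_ballS; exists a, 1.
  by rewrite mulg1 mem1_word_ball !inE aA orbT.
split=> [|x y /asboolP[m xm] /asboolP[n yn]].
  by apply/asboolP; exists 0; exact: mem1_word_ball.
by apply/asboolP; exists (m + n); rewrite word_ballM ?word_ballV.
Qed.

Lemma word_ball_seq : generates A ->
  forall s : seq G, exists k, {subset s <= B k}.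
Proof.
move=> genA; elim=> [|g s [k sk]]; first by exists 0.
have [l gl] := word_ball_exhaust genA g; exists (maxn k l) => h.
rewrite inE => /orP[/eqP->|/sk].
  exact: sub_word_ball (leq_maxr _ _) gl.
exact: sub_word_ball (leq_maxl _ _).
Qed.

(** Select centres by decreasing radius, discarding those already covered.  A
later centre lies outside every earlier ball, and, its own radius being
smaller, symmetry of the balls keeps the earlier centres outside its ball. *)
Lemma separated_subcover (m : G -> nat) (V : {fset G}) :
  exists2 W : {fset G}, (W `<=` V)%fset &
    (forall a, a \in V -> exists2 g, g \in W & a * g^-1 \in B (m g)) /\
    {in W &, forall g h, h != g -> h * g^-1 \notin B (m g)}.
Proof.
have [k] := ubnP #|` V|; elim: k V => // k IHk V.
have [->|[v vV]] := fset_0Vmem V.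
  by exists fset0 => //; split=> [a|g h]; rewrite inE.
rewrite ltnS => leVk.
have [g gV gmax] : exists2 g, g \in V & forall h, h \in V -> m h <= m g.
  case: (@arg_maxnP V [` vV]%fset predT (fun u => m (val u))) => //= g _ gmax.
  exists (val g); first exact: valP.
  by move=> h hV; exact: (gmax [` hV]%fset).
pose V1 := [fset a in V | a * g^-1 \notin B (m g)]%fset.
have V1V : (V1 `<=` V)%fset by apply/fsubsetP => a; rewrite !inE => /andP[].
have /IHk[W WV1 [covW sepW]] : #|` V1| < k.
  apply: leq_trans leVk; apply: fproper_ltn_card; rewrite fproperEneq V1V andbT.
  apply/eqP => /fsetP /(_ g); rewrite !inE gV mulgV mem1_word_ball.
  by [].
exists (g |` W)%fset.
  by apply/fsubsetP => a; rewrite !inE => /orP[/eqP->//|/(fsubsetP WV1)];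
    exact: (fsubsetP V1V).
split=> [a aV|a b].
  have [ag|ag] := boolP (a * g^-1 \in B (m g)).
    by exists g; rewrite ?inE ?eqxx.
  have /covW[h hW ah] : a \in V1 by rewrite !inE aV ag.
  by exists h; rewrite // inE hW orbT.
have farg h : h \in W -> h * g^-1 \notin B (m g).
  by move=> /(fsubsetP WV1); rewrite !inE => /andP[].
have leW h : h \in W -> m h <= m g.
  by move=> /(fsubsetP WV1) /(fsubsetP V1V) /gmax.
rewrite !inE => /orP[/eqP->|aW] /orP[/eqP->|bW]; rewrite ?eqxx//.
- by move=> _; exact: farg.
- move=> _; apply: contra (farg _ aW) => gaB.
  by rewrite word_ball_divC; apply: sub_word_ball gaB; exact: leW.
- exact: sepW.
Qed.

(** For balls, failing to be Besicovitch means that arbitrarily many balls meet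
at one point although none of them contains the centre of another: the cover
of [separated_subcover] must have unbounded multiplicity. *)
Lemma crowded_point (n : nat -> nat) :
    ~ besicovitch (fun i => B (n i)) ->
  forall C, exists h (V : seq G) (m : G -> nat), [/\ uniq V, C < size V,
    {in V, forall g, h * g^-1 \in B (n (m g))} &
    {in V &, forall g g', g' != g -> g' * g^-1 \notin B (n (m g))}].
Proof.
move=> notB C; apply: contrapT => noV; apply: notB.
exists C => V m; have [W WV [covW sepW]] := separated_subcover (n \o m) V.
exists W => // h; apply/andP; split.
  have [/covW[g gW hg]|//] := boolP (h \in V).
  by rewrite (big_fsetD1 g)//= mem_fset_translate hg.
rewrite leqNgt; apply/negP => ltC; apply: noV.
exists h, [seq g <- W | h * g^-1 \in B (n (m g))], m; split.
- by rewrite filter_uniq // fset_uniq.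
- apply: (leq_trans ltC); rewrite size_filter -sum1_count [leqRHS]big_mkcond /=.
  by apply: leq_sum => g _; rewrite mem_fset_translate; case: ifP.
- by move=> g; rewrite mem_filter => /andP[].
- by move=> g g'; rewrite !mem_filter => /andP[_ gW] /andP[_ g'W]; exact: sepW.
Qed.

End WordBalls.

Lemma pigeonhole (T U : eqType) (f : T -> U) (r : nat) (V : seq T) (E : seq U) :
    {in V, forall v, f v \in E} -> r * size E < size V ->
  exists e, r < count (fun v => f v == e) V.
Proof.
elim: E V => [|e E IHE] V fE ltV.
  by case: V fE ltV => // v V /(_ v); rewrite inE eqxx => /(_ isT).
have [ltr|ler] := ltnP r (count (fun v => f v == e) V); first by exists e.
have [v|/=|e' lte'] := IHE [seq v <- V | f v != e].
- by rewrite mem_filter => /andP[fv /fE]; rewrite inE (negPf fv).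
- rewrite size_filter -(ltn_add2l (count (fun v => f v == e) V)) count_predC.
  by rewrite (leq_ltn_trans _ ltV)// mulnS leq_add2r.
- by exists e'; apply: leq_trans lte' _; rewrite count_filter; apply: sub_count
    => v /= /andP[].
Qed.

Section SparseCuts.
Variables (G : groupType) (A : {fset G}) (n : nat -> nat).
Hypothesis symA : symmetric_fset A.
Hypothesis not_besicovitch : forall n : nat -> nat, subsequence_index n ->
  ~ besicovitch (fun i => word_ball A (n i)).
Hypothesis n_sub : subsequence_index n.
Local Notation B := (word_ball A).
Local Open Scope group_scope.

Lemma subsequence_index_ge i : i <= n i.
Proof.
have [_ n_homo] := n_sub; elim: i => // i IHi.
by apply: leq_ltn_trans IHi _; exact: n_homo.
Qed.

Lemma subsequence_index_shift i k : subsequence_index (fun j => n (j + i) + k).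
Proof.
have [n0 n_homo] := n_sub; split=> [|j l ltjl]; last first.
  by rewrite ltn_add2r n_homo// ltn_add2r.
rewrite addn_gt0; apply/orP; left; case: i => // i.
by apply: leq_ltn_trans (n_homo 0 _ _).
Qed.

(** The enlarged radii [n i + k] are again not Besicovitch, so many balls of
such radii about mutually distant centres [g] contain one point [h].  Writing
[h * g^-1] as a word, its first [2 * k] letters take finitely many values; the
centres sharing them have balls of the smaller radii [n i - k] through one
point, which a right translation moves to the identity. *)
Lemma sparse_cuts k r N : exists (C : seq G) (i : G -> nat), [/\ uniq C,
  size C = r, {in C, forall c, [/\ N <= i c, k <= n (i c) &
    c \in B (n (i c) - k)]} &
  {in C &, forall c c', c' != c -> c' * c^-1 \notin B (n (i c) + k)}].
Proof.
pose i0 := maxn N k.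
have := crowded_point symA (not_besicovitch (subsequence_index_shift i0 k)).
move=> /(_ (r * #|` B (k + k)|)%N) [h [V [m [uV ltV hV sepV]]]].
have kn g : k <= n (m g + i0).
  apply: leq_trans (subsequence_index_ge _).
  by rewrite (leq_trans (leq_maxr N k))// leq_addl.
have /choice[e he] : forall g, exists e, g \in V ->
    e \in B (k + k) /\ e^-1 * (h * g^-1) \in B (n (m g + i0) - k).
  move=> g; have [gV|_] := boolP (g \in V); last by exists 1.
  have := hV _ gV; rewrite -[X in B X](_ : (k + k) + (n (m g + i0) - k) = _);
    last by have := kn g; lia.
  by move=> /word_ball_split[a [b [aB bB ->]]]; exists a; rewrite mulKg.
have [e0] := pigeonhole (fun g gV => (he g gV).1) ltV.
rewrite -size_filter; set V0 := (X in size X) => ltV0.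
have V0P g : g \in V0 -> g \in V /\ e g = e0.
  by rewrite mem_filter => /andP[/eqP].
pose p := e0^-1 * h.
exists [seq g * p^-1 | g <- take r V0], (fun c => m (c * p) + i0); split.
- rewrite map_inj_uniq; last exact: mulIg.
  by rewrite take_uniq// filter_uniq.
- by rewrite size_map size_takel// ltnW.
- move=> _ /mapP[g /mem_take /V0P[gV eg] ->]; rewrite mulgVK; split=> //.
    by rewrite (leq_trans (leq_maxl N k))// leq_addl.
  have [_] := he g gV; rewrite eg mulgA => /(word_ballV symA).
  by rewrite invgM invgK.
- move=> c c' /mapP[g /mem_take /V0P[gV _] ->].
  move=> /mapP[g' /mem_take /V0P[g'V _] ->].
  rewrite mulgVK mulgKA => neq; apply: sepV => //.
  by apply: contra neq => /eqP->.
Qed.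

End SparseCuts.

(** * Towers of labelled cells *)

(** Cutting and stacking data.  The list [level n] labels the cells of stage
[n], and [spacers n] the cells that are new at stage [n.+1].  Cuts multiply
labels on the right so that the partial translations of cells, which multiply
them on the left, restrict to the slices.  By [level_absorb] every [g] is
eventually defined at every point. *)
Record tower (G : groupType) := Tower {
  level : nat -> seq G;
  cuts : nat -> seq G;
  spacers : nat -> seq G;
  level0 : level 0 = [:: 1%g];
  levelS : forall n,
    level n.+1 = [seq (f * c)%g | f <- level n, c <- cuts n] ++ spacers n;
  level_uniq : forall n, uniq (level n);
  cuts_gt1 : forall n, 1 < size (cuts n);
  level_absorb : forall g, exists N, forall n, N <= n ->
    forall f c, f \in level n -> c \in cuts n ->
    (g * (f * c))%g \in level n.+1 }.

Section ErraticTower.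
Variables (G : groupType) (A : {fset G}) (n : nat -> nat).
Hypothesis symA : symmetric_fset A.
Hypothesis genA : generates A.
Hypothesis not_besicovitch : forall n : nat -> nat, subsequence_index n ->
  ~ besicovitch (fun i => word_ball A (n i)).
Hypothesis n_sub : subsequence_index n.
Local Notation B := (word_ball A).
Local Open Scope group_scope.

(** [i] is the time at which points of the slice [c] see bad ratios: the ball of
radius [n i] moves the slice [c] of any cell to each label in [s], but among
the slices only to those of the cut [c].  The last clause makes these moves
take place within the cells labelled by [s']. *)
Definition erratic_cuts (N : nat) (s C s' : seq G) : Prop :=
  forall c, c \in C -> exists i, [/\ N <= i,
    {in s &, forall f f', f' * (f * c)^-1 \in B (n i)},
    {in s &, forall f f', {in C, forall c',
       f' * c' * (f * c)^-1 \in B (n i) -> c' = c}} &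
    forall g f, g \in B (n i) -> f \in s -> g * (f * c) \in s'].

(** If [s] lies in the ball of radius [k], the products [f' * c] and [f * c] have
a quotient that differs from [c' * c^-1], or from [c^-1] when [c'] is absent, by
factors from this ball on either side; hence the slack [k + k] in the cuts.
Adding to [s'] the translates of all slices by a large ball yields the
remaining clauses. *)
Lemma next_level N r (s : seq G) : uniq s -> exists C S : seq G,
  let s' := [seq f * c | f <- s, c <- C] ++ S in
  [/\ size C = r, uniq s', {subset s <= s'},
    (forall g f c, g \in B N -> f \in s -> c \in C -> g * (f * c) \in s') &
    erratic_cuts N s C s'].
Proof.
move=> us; have [k sk] := word_ball_seq symA genA s.
have [C [i [uC sizeC nearC farC]]] :=
  sparse_cuts symA not_besicovitch n_sub (k + k) r N.
have fc_inj f f' c c' : f \in s -> f' \in s -> c \in C -> c' \in C ->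
    f' * c' * (f * c)^-1 \in B (n (i c)) -> c' = c.
  move=> /sk fk /sk f'k cC c'C fcB.
  apply/eqP; apply: contraT => neq; have := farC _ _ cC c'C neq.
  have -> : c' * c^-1 = f'^-1 * (f' * c' * (f * c)^-1 * f).
    by rewrite invgM !mulgA mulVg mul1g mulgVK.
  rewrite (_ : _ + _ = k + (n (i c) + k))%N; last by lia.
  by rewrite !word_ballM// word_ballV.
pose fC := [seq f * c | f <- s, c <- C].
have ufC : uniq fC.
  apply: allpairs_uniq => // [[f c] [f' c']] /=.
  move=> /allpairsP[[? ?] [/= fs cC [-> ->]]].
  move=> /allpairsP[[? ?] [/= f's c'C [-> ->]]] eq_fc.
  have eq_c := fc_inj _ _ _ _ f's fs c'C cC.
  rewrite eq_fc mulgV mem1_word_ball in eq_c.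
  by move: eq_fc; rewrite eq_c// => /mulIg->.
(* A radius that dominates [N] and all the times of the cuts. *)
pose m := N + \sum_(c <- C) n (i c).
have leNm g : g \in B N -> g \in B m by apply: sub_word_ball; rewrite leq_addr.
have leim c g : c \in C -> g \in B (n (i c)) -> g \in B m.
  move=> cC; apply: sub_word_ball; rewrite /m (big_rem c)//=.
  by rewrite addnCA leq_addr.
pose T := s ++ [seq g * h | g <- B m : seq G, h <- fC].
pose S := [seq h <- undup T | h \notin fC].
have memS h : h \in T -> h \in fC ++ S.
  by move=> hT; rewrite mem_cat mem_filter mem_undup hT andbT orbN.
have absorbs g f c : g \in B m -> f \in s -> c \in C -> g * (f * c) \in fC ++ S.
  move=> gm fs cC; apply: memS; rewrite mem_cat; apply/orP; right.
  by apply: allpairs_f => //; exact: allpairs_f.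
exists C, S; split=> //.
- rewrite cat_uniq ufC filter_uniq ?undup_uniq// andbT.
  by apply/hasPn => h; rewrite mem_filter => /andP[].
- by move=> f fs; apply: memS; rewrite mem_cat fs.
- by move=> g f c /leNm; exact: absorbs.
move=> c cC; have [leN lek cB] := nearC _ cC; exists (i c); split=> //.
- move=> f f' /sk fk /sk f'k; rewrite invgM.
  rewrite (_ : n (i c) = k + ((n (i c) - (k + k)) + k))%N; last by lia.
  by rewrite !word_ballM// word_ballV.
- by move=> f f' fs f's c' c'C; exact: fc_inj.
- by move=> g f gB fs; apply: absorbs => //; exact: leim gB.
Qed.

(** With [2 ^ N.+2] cuts at stage [N] the inverses of the numbers of cuts have sum
[1 / 2]. *)
Lemma erratic_tower : exists t : tower G, forall N, [/\
  size (cuts t N) = (2 ^ N.+2)%N, {subset level t N <= level t N.+1} &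
  erratic_cuts N (level t N) (cuts t N) (level t N.+1)].
Proof.
have /choice[F FP] : forall Ns : nat * seq G, exists CS : seq G * seq G,
    uniq Ns.2 -> let s' := [seq f * c | f <- Ns.2, c <- CS.1] ++ CS.2 in
  [/\ size CS.1 = (2 ^ Ns.1.+2)%N, uniq s', {subset Ns.2 <= s'},
    (forall g f c, g \in B Ns.1 -> f \in Ns.2 -> c \in CS.1 ->
      g * (f * c) \in s') & erratic_cuts Ns.1 Ns.2 CS.1 s'].
  move=> [N s]; have [us|_] := boolP (uniq s); last by exists ([::], [::]).
  by have [C [S CS]] := next_level N (2 ^ N.+2)%N us; exists (C, S).
pose s := fix s N := if N is N'.+1 then
  [seq f * c | f <- s N', c <- (F (N', s N')).1] ++ (F (N', s N')).2
  else [:: 1 : G].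
have us N : uniq (s N).
  by elim: N => // N us; have [_ ? _ _ _] := FP (N, s N) us.
have absorb g : exists N, forall m, N <= m -> forall f c, f \in s m ->
    c \in (F (m, s m)).1 -> g * (f * c) \in s m.+1.
  have [N gN] := word_ball_exhaust symA genA g; exists N => m leNm f c fs cC.
  have [_ _ _ + _] := FP (m, s m) (us m); apply=> //.
  exact: sub_word_ball gN.
have gt1 N : 1 < size (F (N, s N)).1.
  by have [-> _ _ _ _] := FP (N, s N) (us N); rewrite (ltn_exp2l 0).
exists (@Tower G s (fun N => (F (N, s N)).1) (fun N => (F (N, s N)).2)
  erefl (fun=> erefl) us gt1 absorb) => N /=.
by have [? _ ? _ ?] := FP (N, s N) (us N).
Qed.

End ErraticTower.

(** * The action attached to a tower *)

Lemma nth_allpairs (S T U : Type) (f : S -> T -> U) s t i j x0 y0 z0 :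
    (i < size s)%N -> (j < size t)%N ->
  nth z0 [seq f x y | x <- s, y <- t] (i * size t + j)
    = f (nth x0 s i) (nth y0 t j).
Proof.
move=> + ltj; elim: s i => // x s IHs [|i] lti;
  rewrite allpairs_cons nth_cat size_map.
  by rewrite mul0n add0n ltj (nth_map y0).
by rewrite mulSn -addnA ltnNge leq_addr /= addKn IHs.
Qed.

Local Open Scope classical_set_scope.
Local Open Scope ring_scope.

Section TowerAction.
Variables (R : realType) (G : groupType) (t : tower G).
Implicit Types (n : nat) (g : G) (x : R).

(** The number of cells of stage [n] in the unit interval, hence the inverse of
their common length. *)
Definition slices n : nat := \prod_(i < n) size (cuts t i).

Lemma slices0 : slices 0 = 1%N. Proof. by rewrite /slices big_ord0. Qed.

Lemma slicesS n : slices n.+1 = (slices n * size (cuts t n))%N.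
Proof. by rewrite /slices big_ord_recr. Qed.

Lemma slices_gt n : (n < slices n)%N.
Proof.
elim: n => [|n IHn]; first by rewrite slices0.
rewrite slicesS; apply: (leq_ltn_trans IHn).
by rewrite -[ltnLHS]muln1 ltn_pmul2l ?cuts_gt1// (leq_ltn_trans _ IHn).
Qed.

Lemma slices_gt0 n : (0 < slices n)%N.
Proof. exact: leq_ltn_trans (slices_gt n). Qed.

Lemma slicesR_gt0 n : 0 < (slices n)%:R :> R.
Proof. by rewrite ltr0n slices_gt0. Qed.

Lemma slicesR_neq0 n : (slices n)%:R != 0 :> R.
Proof. by rewrite lt0r_neq0 ?slicesR_gt0. Qed.

Lemma leq_slices_level n : (slices n <= size (level t n))%N.
Proof.
elim: n => [|n IHn]; first by rewrite slices0 level0.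
rewrite slicesS levelS size_cat size_allpairs.
by apply: leq_trans (leq_addr _ _); rewrite leq_mul2r IHn orbT.
Qed.

(** The number of the cell of stage [n] containing [x], cells being placed from
left to right as they are listed in [level t n]; [stage] excludes the negative
[x], where the value is junk, and the [x] beyond the last cell. *)
Definition rung n x : nat := Num.truncn (x * (slices n)%:R).

Definition stage n x : bool := (0 <= x) && (rung n x < size (level t n))%N.

Definition label n x : G := nth 1%g (level t n) (rung n x).

Lemma rung_itv n x : 0 <= x ->
  (rung n x)%:R <= x * (slices n)%:R < (rung n x).+1%:R.
Proof. by move=> x0; apply: truncn_itv; rewrite mulr_ge0. Qed.

Lemma rungS n x : 0 <= x -> rung n x = (rung n.+1 x %/ size (cuts t n))%N.
Proof.
move=> x0; apply: truncn_def.
have /andP[] := rung_itv n.+1 x0; rewrite slicesS natrM mulrA.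
set r := size _; set J := rung _ _ => leJ ltJ.
have r0 : (0 < r)%N by apply: ltnW; exact: cuts_gt1.
have rR0 : 0 < r%:R :> R by rewrite ltr0n.
apply/andP; split.
  rewrite -(ler_pM2r rR0); apply: le_trans leJ.
  by rewrite -natrM ler_nat leq_divM.
rewrite -(ltr_pM2r rR0); apply: lt_le_trans ltJ _.
by rewrite -natrM ler_nat ltn_ceil.
Qed.

Lemma mem_label n x : stage n x -> label n x \in level t n.
Proof. by move=> /andP[_ ltx]; rewrite mem_nth. Qed.

Lemma index_label n x : stage n x -> index (label n x) (level t n) = rung n x.
Proof. by move=> /andP[_ ltx]; rewrite index_uniq ?level_uniq. Qed.

Lemma rung_mod n x : (rung n.+1 x %% size (cuts t n) < size (cuts t n))%N.
Proof. by rewrite ltn_mod; apply: ltnW; exact: cuts_gt1. Qed.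

Lemma levelS_nth n i j : (i < size (level t n))%N -> (j < size (cuts t n))%N ->
  (i * size (cuts t n) + j < size (level t n.+1))%N /\
  nth 1%g (level t n.+1) (i * size (cuts t n) + j)
    = (nth 1 (level t n) i * nth 1 (cuts t n) j)%g.
Proof.
move=> lti ltj; rewrite levelS size_cat nth_cat size_allpairs.
have lt : (i * size (cuts t n) + j < size (level t n) * size (cuts t n))%N.
  apply: (@leq_trans (i.+1 * size (cuts t n))).
    by rewrite mulSnr ltn_add2l.
  by rewrite leq_mul2r lti orbT.
rewrite lt (@nth_allpairs _ _ _ _ _ _ _ _ 1%g 1%g)//.
by rewrite (leq_trans lt) ?leq_addr.
Qed.

Definition cut_of n x : G :=
  nth 1%g (cuts t n) (rung n.+1 x %% size (cuts t n)).

Lemma mem_cut_of n x : cut_of n x \in cuts t n.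
Proof. by rewrite mem_nth// rung_mod. Qed.

Lemma stageS n x : stage n x ->
  stage n.+1 x /\ label n.+1 x = (label n x * cut_of n x)%g.
Proof.
move=> /andP[x0]; rewrite /stage x0 (rungS _ x0) => ltx.
have [lt1] := levelS_nth ltx (rung_mod n x); rewrite -divn_eq in lt1 *.
by rewrite -(rungS _ x0).
Qed.

Lemma stage_le m n x : (m <= n)%N -> stage m x -> stage n x.
Proof.
by move=> /subnKC<-; elim: (n - m)%N => [|k IHk];
  rewrite ?addn0 ?addnS// => /IHk /stageS[].
Qed.

Definition defined n g x := stage n x && ((g * label n x)%g \in level t n).

Definition slide n g x : R :=
  x + ((index (g * label n x)%g (level t n))%:R - (rung n x)%:R)
      / (slices n)%:R.

(** The slices of a cell are listed in the order of [cuts t n] in every cell, so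
translating a cell translates its slices by the same amount. *)
Lemma definedS n g x : defined n g x ->
  defined n.+1 g x /\ slide n.+1 g x = slide n g x.
Proof.
move=> /andP[xn gn]; have [xn1 lbl] := stageS xn.
have [x0 ltx] := andP xn.
have lti : (index (g * label n x)%g (level t n) < size (level t n))%N.
  by rewrite index_mem.
have [lt1] := levelS_nth lti (rung_mod n x).
rewrite nth_index// -/(cut_of n x) -mulgA -lbl => nth1.
have gn1 : (g * label n.+1 x)%g \in level t n.+1 by rewrite -nth1 mem_nth.
split; first by rewrite /defined xn1.
rewrite /slide -nth1 index_uniq ?level_uniq//; congr (_ + _).
have -> : (rung n.+1 x)%:R
    = (rung n x * size (cuts t n) + rung n.+1 x %% size (cuts t n))%:R :> R.
  by rewrite [in RHS](rungS n x0) -divn_eq.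
rewrite !natrD opprD addrACA subrr addr0 slicesS !natrM -mulrBl -mulf_div.
rewrite divff ?mulr1//.
by rewrite pnatr_eq0 -lt0n; apply: ltnW; exact: cuts_gt1.
Qed.

Lemma defined_le m n g x : (m <= n)%N -> defined m g x ->
  defined n g x /\ slide n g x = slide m g x.
Proof.
move=> /subnKC<-; elim: (n - m)%N => [|k IHk]; rewrite ?addn0 ?addnS//.
by move=> /IHk[/definedS[? ->] ->].
Qed.

(** By [defined_le] the choice of a stage is immaterial.  Off [tower_space] the
action is trivial, which is harmless since that set is null. *)
Definition transport g x : R :=
  if pselect (exists n, defined n g x) is left ex then slide (ex_minn ex) g x
  else x.

Lemma transportE n g x : defined n g x -> transport g x = slide n g x.
Proof.
move=> gnx; rewrite /transport; case: pselect => [ex|[]]; last by exists n.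
case: ex_minnP => m gmx le_m; have [_ ->//] := defined_le (le_m _ gnx) gmx.
Qed.

Lemma rung_slide n g x : defined n g x ->
  0 <= slide n g x /\
  rung n (slide n g x) = index (g * label n x)%g (level t n).
Proof.
move=> /andP[/andP[x0 _] _]; set i := index _ _.
have /andP[lex ltx] := rung_itv n x0.
have slideE : slide n g x * (slices n)%:R
    = x * (slices n)%:R + i%:R - (rung n x)%:R.
  by rewrite /slide mulrDl divfK ?slicesR_neq0// addrA.
split; last first.
  apply: truncn_def; rewrite slideE -(natr1 i); rewrite -natr1 in ltx; lra.
rewrite -(pmulr_lge0 _ (slicesR_gt0 n)) slideE.
have : 0 <= i%:R :> R by []. lra.
Qed.

Lemma label_transport n g x : defined n g x ->
  stage n (transport g x) /\ label n (transport g x) = (g * label n x)%g.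
Proof.
move=> gnx; rewrite (transportE gnx) /stage /label.
have [-> ->] := rung_slide gnx; have /andP[_ gn] := gnx.
by rewrite index_mem gn nth_index.
Qed.

Definition tower_space : set R := [set x | exists n, stage n x].

(** One stage after [x] has appeared, its label is a product [f * c], which is
what [level_absorb] requires. *)
Lemma eventually_defined g x : tower_space x ->
  exists N, forall n, (N <= n)%N -> defined n g x.
Proof.
move=> [n xn]; have [N absorb] := level_absorb t g.
exists (maxn n N).+1 => -[//|m]; rewrite ltnS geq_max => /andP[lenm leNm].
have /stageS[xm1 lbl] := stage_le lenm xn.
rewrite /defined xm1 lbl absorb ?mem_cut_of//.
exact/mem_label/(stage_le lenm).
Qed.

Lemma transport_space g x : tower_space (transport g x) <-> tower_space x.
Proof.
split=> [|sx]; last first.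
  have [N /(_ N (leqnn N))] := eventually_defined g sx.
  by move=> /label_transport[? _]; exists N.
rewrite /transport; case: pselect => // -[n /andP[xn _]] _; by exists n.
Qed.

Lemma transport_out g x : ~ tower_space x -> transport g x = x.
Proof.
by rewrite /transport; case: pselect => // -[n /andP[xn _]] []; exists n.
Qed.

Lemma transport1 x : transport 1%g x = x.
Proof.
have [sx|] := pselect (tower_space x); last exact: transport_out.
have [N /(_ N (leqnn N)) dx] := eventually_defined 1%g sx.
rewrite (transportE dx) /slide mul1g.
by have /andP[xN _] := dx; rewrite index_label// subrr mul0r addr0.
Qed.

Lemma transportM g h x : transport (g * h)%g x = transport g (transport h x).
Proof.
have [sx|nsx] := pselect (tower_space x); last by rewrite !transport_out.
have [M hM] := eventually_defined h sx.
have [N ghN] := eventually_defined (g * h)%g sx.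
pose n := maxn M N; have hn : defined n h x by apply: hM; rewrite leq_maxl.
have ghn : defined n (g * h)%g x by apply: ghN; rewrite leq_maxr.
have [yn lbl] := label_transport hn.
have gn : defined n g (transport h x).
  by rewrite /defined yn lbl mulgA; have /andP[] := ghn.
rewrite (transportE ghn) (transportE gn) /slide lbl mulgA.
rewrite (transportE hn) (rung_slide hn).2 /slide -addrA -mulrDl.
by congr (_ + _ / _); rewrite [RHS]addrC addrA subrK.
Qed.

Lemma transportK g : cancel (transport g) (transport g^-1%g).
Proof. by move=> x; rewrite -transportM mulVg transport1. Qed.

Lemma transportVK g : cancel (transport g^-1%g) (transport g).
Proof. by move=> x; rewrite -transportM mulgV transport1. Qed.

End TowerAction.

(** * Piecewise translations of the line *)

Section PiecewiseTranslation.
Variable R : realType.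
Local Notation leb := (@lebesgue_measure R).

Lemma measurable_preimage_shift (c : R) (B : set R) : measurable B ->
  measurable ((fun x => x + c) @^-1` B).
Proof.
by move=> mB; rewrite -[X in measurable X]setTI; apply: measurable_funD.
Qed.

Lemma lebesgue_measure_shift (c : R) (B : set R) : measurable B ->
  leb ((fun x => x + c) @^-1` B) = leb B.
Proof.
move=> mB; pose f : R -> measurableTypeR R := fun x => x + c.
rewrite -/(pushforward leb f B).
have mf : measurable_fun [set: R] f by exact: measurable_funD.
apply/esym/lebesgue_measure_unique => //= _ [[a b]] _ <-.
rewrite /pushforward (_ : _ @^-1` _ = `]a - c, b - c]%classic); last first.
  by apply/seteqP; split=> x /=; rewrite !in_itv /= ltrBlDr lerBrDr.
rewrite !lebesgue_measure_itv /= !lte_fin ltrD2r.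
by case: ifP => // _; rewrite -!EFinB opprB addrA subrK.
Qed.

Variables (T S : R -> R) (P : nat -> set R) (c : nat -> R) (D : set R).
Hypothesis TK : cancel T S.
Hypothesis SK : cancel S T.
Hypothesis TD : forall x, D (T x) <-> D x.
Hypothesis mP : forall k, measurable (P k).
Hypothesis PD : \bigcup_k P k = D.
Hypothesis TP : forall k x, P k x -> T x = x + c k.

Let Q k : set R := S @^-1` P k.

Let preimageQ k : T @^-1` Q k = P k.
Proof. by apply/seteqP; split=> x; rewrite /Q /= TK. Qed.

Let QE k : Q k = (fun y => y + - c k) @^-1` P k.
Proof.
apply/seteqP; split=> y; rewrite /Q /=.
  by move=> Py; have := TP Py; rewrite SK => yE; rewrite {1}yE addrK.
by move=> Py; have := TP Py; rewrite subrK => <-; rewrite TK.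
Qed.

Let mQ k : measurable (Q k).
Proof. by rewrite QE; exact: measurable_preimage_shift. Qed.

Let QD : \bigcup_k Q k = D.
Proof.
apply/seteqP; split=> y; rewrite -PD.
  by move=> [k _ Py]; rewrite PD -(SK y) TD -PD; exists k.
by rewrite PD -{1}(SK y) TD -PD => -[k _ Py]; exists k.
Qed.

Let preimage_piece k (B : set R) :
  T @^-1` B `&` P k = (fun x => x + c k) @^-1` (B `&` Q k).
Proof.
apply/seteqP; split=> x /=.
  move=> [Bx Px]; rewrite -(TP Px); split=> //.
  by rewrite /Q /= TK.
rewrite QE /= addrK => -[Bx Px]; split=> //.
by rewrite (TP Px).
Qed.

Lemma measurable_piecewise_translation (B : set R) : measurable B ->
  measurable (T @^-1` B `&` D).
Proof.
move=> mB; rewrite -PD setI_bigcupr; apply: bigcupT_measurable => k.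
by rewrite preimage_piece; apply: measurable_preimage_shift; exact: measurableI.
Qed.

(** The pieces [P k] need not be disjoint, but [T] also carries the pieces
[seqDU P k] to the pieces [seqDU Q k], which are. *)
Lemma lebesgue_piecewise_translation (B : set R) : measurable B ->
  leb (T @^-1` B `&` D) = leb (B `&` D).
Proof.
move=> mB.
have preimageDU k : T @^-1` seqDU Q k = seqDU P k.
  rewrite /seqDU -(preimageQ k) -!bigcup_mkord.
  by rewrite (eq_bigcupr (fun i _ => esym (preimageQ i))) -preimage_bigcup.
rewrite -{1}PD -QD (seqDU_bigcup_eq P) (seqDU_bigcup_eq Q) !setI_bigcupr.
have mDUQ := seqDU_measurable mQ; have mDUP := seqDU_measurable mP.
have pieceDU k : T @^-1` B `&` seqDU P k
    = (fun x => x + c k) @^-1` (B `&` seqDU Q k).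
  apply/seteqP; split=> x [Bx].
    move=> DPx; have Px := subset_seqDU DPx; rewrite -preimageDU in DPx.
    by rewrite /preimage /= -(TP Px).
  move=> DQx; have := subset_seqDU DQx; rewrite QE /preimage /= addrK => Px.
  by rewrite /preimage /= -preimageDU /preimage /= (TP Px).
rewrite !measure_bigcup//.
- apply: eq_eseriesr => k _; rewrite pieceDU.
  by apply: lebesgue_measure_shift; exact: measurableI.
- by move=> k _; apply: measurableI => //; exact: mDUQ.
- exact/trivIset_setIl/trivIset_seqDU.
- move=> k _; rewrite pieceDU; apply: measurable_preimage_shift.
  by apply: measurableI => //; exact: mDUQ.
- exact/trivIset_setIl/trivIset_seqDU.
Qed.

End PiecewiseTranslation.

(** * The invariant measure *)

Section TowerMeasure.
Variables (R : realType) (G : groupType) (t : tower G).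
Local Notation leb := (@lebesgue_measure R).
Local Notation D := (@tower_space R G t).
Local Notation nlevel n := (size (level t n)).

Definition tower_cell n j : set R :=
  `[j%:R / (slices t n)%:R, j.+1%:R / (slices t n)%:R[%classic.

Local Notation cell := tower_cell.

Lemma cellP n j x : cell n j x <-> 0 <= x /\ rung t n x = j.
Proof.
rewrite /tower_cell /= in_itv /= ler_pdivrMr ?slicesR_gt0//.
rewrite ltr_pdivlMr ?slicesR_gt0//; split=> [jx|[x0 <-]]; last exact: rung_itv.
split; last exact: truncn_def.
rewrite -(pmulr_lge0 _ (slicesR_gt0 R t n)).
by have /andP[jx1 _] := jx; apply: le_trans jx1.
Qed.

Lemma measurable_cell n j : measurable (cell n j).
Proof. exact: measurable_itv. Qed.

Lemma stageE n :
  [set x : R | stage t n x] = `[0, (nlevel n)%:R / (slices t n)%:R[%classic.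
Proof.
rewrite predeqE => x /=; rewrite /stage.
rewrite in_itv /=.
case: (boolP (0 <= x)) => //= x0.
rewrite /rung truncn_lt_nat ?mulr_ge0//.
by rewrite ltr_pdivlMr// slicesR_gt0.
Qed.

Lemma measurable_tower_space : measurable D.
Proof.
rewrite (_ : D = \bigcup_n [set x : R | stage t n x]); last first.
  by apply/seteqP; split=> [x [n xn]|x [n _ xn]]; exists n.
by apply: bigcupT_measurable => n; rewrite stageE; exact: measurable_itv.
Qed.

Definition tower_measure : set (measurableTypeR R) -> \bar R :=
  mrestr leb measurable_tower_space.
Local Notation mu := tower_measure.

HB.instance Definition _ := Measure.on mu.

Lemma tower_measure_fin (B : set R) (x : R) : measurable B ->
  B `<=` `]-oo, x[ -> (mu B < +oo)%E.
Proof.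
move=> mB Bx; rewrite /mu /mrestr.
apply: (@le_lt_trans _ _ (leb `[0, x]%classic)); last first.
  by rewrite lebesgue_measure_itv /=; case: ifP => //; rewrite ltry.
apply: le_measure; rewrite ?inE; [|exact: measurable_itv|].
  exact: measurableI _ _ mB measurable_tower_space.
move=> y [/Bx /=]; rewrite !in_itv /= => /ltW-> [n /andP[-> _]].
by [].
Qed.

Lemma tower_measure_sigma_finite : sigma_finite [set: R] mu.
Proof.
exists (fun n => `]-oo, n%:R[%classic) => [|n].
  apply/seteqP; split=> // x _; exists (Num.truncn x).+1 => //=.
  by rewrite in_itv /= truncnS_gt.
split; first exact: measurable_itv.
by apply: (@tower_measure_fin _ n%:R); first exact: measurable_itv.
Qed.

HB.instance Definition _ :=
  @Measure_isSigmaFinite.Build _ _ R mu tower_measure_sigma_finite.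

(** The pieces on which [transport t g] is a translation are the cells of all
stages whose translate by [g] exists, numbered by encoding pairs in [nat]. *)
Definition piece (g : G) (k : nat) : set R :=
  if (choice.unpickle k : option (nat * nat)) is Some nj then
    [set x | defined t nj.1 g x /\ rung t nj.1 x = nj.2] else set0.

Definition piece_shift (g : G) (k : nat) : R :=
  if (choice.unpickle k : option (nat * nat)) is Some (n, j) then
    ((index (g * nth 1 (level t n) j)%g (level t n))%:R - j%:R)
      / (slices t n)%:R
  else 0.

Lemma measurable_piece g k : measurable (piece g k).
Proof.
rewrite /piece; case: choice.unpickle => [[n j]|] /=; last exact: measurable0.
have [/andP[ltj gj]|nj] := boolP ((j < nlevel n)%N &&
    ((g * nth 1 (level t n) j)%g \in level t n)).
  rewrite (_ : [set _ | _] = cell n j); first exact: measurable_cell.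
  apply/seteqP; split=> x /=.
    by move=> [/andP[/andP[x0 _] _] rx]; apply/cellP.
  by move=> /cellP[x0 rx]; rewrite /defined /stage /label rx x0 ltj.
rewrite (_ : [set _ | _] = set0); first exact: measurable0.
apply/seteqP; split=> // x /= [/andP[/andP[_ ltx] gx] rx].
by move/negP: nj; apply; rewrite -rx ltx.
Qed.

Lemma bigcup_piece g : \bigcup_k piece g k = D.
Proof.
apply/seteqP; split=> x.
  rewrite /piece => -[k _].
  case: choice.unpickle => [[n j]|//] /= [/andP[xn _] _].
  by exists n.
move=> sx; have [N /(_ N (leqnn N)) dx] := eventually_defined g sx.
by exists (choice.pickle (N, rung t N x)) => //; rewrite /piece choice.pickleK.
Qed.

Lemma transport_piece g k x :
  piece g k x -> transport t g x = x + piece_shift g k.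
Proof.
rewrite /piece /piece_shift; case: choice.unpickle => [[n j]|//] /= [dx <-].
by rewrite (transportE dx).
Qed.

Let measurable_transportI g B : measurable B ->
  measurable (transport t g @^-1` B `&` D).
Proof.
apply: (@measurable_piecewise_translation R _ (transport t g^-1%g) (piece g)
  (piece_shift g)).
- exact: transportK.
- exact: transportVK.
- exact: measurable_piece.
- exact: bigcup_piece.
- exact: transport_piece.
Qed.

Lemma measurable_transport g : measurable_fun [set: R] (transport t g).
Proof.
move=> _ B mB; rewrite setTI -(setUIDK (transport t g @^-1` B) D).
apply: measurableU; first exact: measurable_transportI.
rewrite (_ : _ `\` D = B `\` D).
  exact: measurableD _ _ mB measurable_tower_space.
by apply/seteqP; split=> x /= [Bx nDx]; split=> //; move: Bx;
  rewrite transport_out.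
Qed.

Lemma transport_preserving g B : measurable B ->
  mu (transport t g @^-1` B) = mu B.
Proof.
apply: (@lebesgue_piecewise_translation R _ (transport t g^-1%g) (piece g)
  (piece_shift g)).
- exact: transportK.
- exact: transportVK.
- exact: transport_space.
- exact: measurable_piece.
- exact: bigcup_piece.
- exact: transport_piece.
Qed.

Lemma transport_action : measure_preserving_action mu (transport t).
Proof.
split.
- exact: transport1.
- exact: transportM.
- exact: measurable_transport.
- exact: transport_preserving.
Qed.

End TowerMeasure.

(** * Ergodicity and absence of atoms *)

Section TowerErgodicity.
Variables (R : realType) (G : groupType) (t : tower G).
Local Notation leb := (@lebesgue_measure R).
Local Notation mu := (@tower_measure R G t).
Local Notation D := (@tower_space R G t).
Local Notation nlevel n := (size (level t n)).
Local Notation cell := (@tower_cell R G t).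

Lemma tower_measure_cell n j :
  (mu (cell n j) <= ((slices t n)%:R^-1)%:E)%E.
Proof.
apply: (@le_trans _ _ (leb (cell n j))).
  apply: le_measure; rewrite ?inE; [|exact: measurable_cell|exact: subIsetl].
  by apply: measurableI; [exact: measurable_cell|exact: measurable_tower_space].
rewrite lebesgue_measure_itv /= lte_fin ltr_pM2r ?invr_gt0 ?slicesR_gt0//.
by rewrite ltr_nat ltnSn -EFinB -mulrBl -natr1 addrAC subrr add0r mul1r.
Qed.

Lemma transport_cell n i j x : (i < nlevel n)%N -> (j < nlevel n)%N ->
  cell n i x ->
  cell n j (transport t (nth 1 (level t n) j * (nth 1 (level t n) i)^-1)%g x).
Proof.
move=> lti ltj /cellP[x0 rx]; set g := (_ * _)%g.
have gl : (g * label t n x)%g = nth 1%g (level t n) j.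
  by rewrite /label rx /g mulgVK.
have dx : defined t n g x by rewrite /defined /stage x0 rx lti gl mem_nth.
apply/cellP; rewrite (transportE dx); have [-> ->] := rung_slide dx.
by rewrite gl index_uniq ?level_uniq.
Qed.

Lemma invariant_cell (B : set R) n i j : measurable B ->
    (forall g, transport t g @^-1` B = B) ->
    (i < nlevel n)%N -> (j < nlevel n)%N ->
  mu (B `&` cell n i) = mu (B `&` cell n j).
Proof.
move=> mB invB lti ltj.
pose g := (nth 1 (level t n) j * (nth 1 (level t n) i)^-1)%g.
have <- : mu (transport t g @^-1` (B `&` cell n j)) = mu (B `&` cell n j).
  apply: transport_preserving.
  by apply: measurableI => //; exact: measurable_cell.
rewrite preimage_setI invB; congr (mu (_ `&` _)).
apply/seteqP; split=> x; first exact: transport_cell.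
move=> /(transport_cell ltj lti).
by rewrite -[X in transport t X](_ : g^-1 = _)%g ?transportK// /g invgM invgK.
Qed.

Definition initial n i : set R := `[0, i%:R / (slices t n)%:R[%classic.

Lemma initialS n i : initial n i.+1 = initial n i `|` cell n i.
Proof.
apply/seteqP; split=> x; rewrite /initial /tower_cell /= !in_itv /=.
  move=> /andP[x0 ltx]; have [lex|gtx] := leP (i%:R / (slices t n)%:R) x.
    by right; rewrite ltx.
  by left; rewrite x0.
case=> [/andP[-> ltx]|/andP[lex ->]].
  apply: (lt_le_trans ltx).
  by rewrite ler_pM2r ?invr_gt0 ?slicesR_gt0// ler_nat.
by rewrite andbT; apply: le_trans lex; rewrite divr_ge0.
Qed.

Lemma initial_cell_disj n i : initial n i `&` cell n i = set0.
Proof.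
apply/seteqP; split=> // x []; rewrite /initial /tower_cell /= !in_itv /=.
by move=> /andP[_ ltx] /andP[/(lt_le_trans ltx)]; rewrite ltxx.
Qed.

Lemma invariant_initial (B : set R) n i : measurable B ->
    (forall g, transport t g @^-1` B = B) -> (i <= nlevel n)%N ->
  mu (B `&` initial n i) = (i%:R%:E * mu (B `&` cell n 0))%E.
Proof.
move=> mB invB; elim: i => [|i IHi] lei.
  by rewrite /initial mul0r set_itvco0 setI0 measure0 mul0e.
have mi : measurable (initial n i) by exact: measurable_itv.
rewrite initialS setIUr.
have -> : mu (B `&` initial n i `|` B `&` cell n i)
    = (mu (B `&` initial n i) + mu (B `&` cell n i))%E.
  apply: measureU.
  - exact: measurableI.
  - by apply: measurableI => //; exact: measurable_cell.
  - by rewrite setIACA initial_cell_disj setI0.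
rewrite (IHi (ltnW lei)) (@invariant_cell _ _ i 0)//; last first.
  exact: leq_ltn_trans lei.
by rewrite -natr1 EFinD ge0_muleDl ?lee_fin// mul1e.
Qed.

Lemma initial_slices n : initial n (slices t n) = `[0, 1[%classic.
Proof. by rewrite /initial divff// slicesR_neq0. Qed.

Lemma initial_space n i : (i <= nlevel n)%N -> initial n i `<=` D.
Proof.
move=> lei x; rewrite /initial /= in_itv /= => /andP[x0 ltx].
exists n; rewrite /stage x0 /rung truncn_lt_nat ?mulr_ge0//.
rewrite -ltr_pdivlMr ?slicesR_gt0//; apply: lt_le_trans ltx _.
by rewrite ler_pM2r ?invr_gt0 ?slicesR_gt0// ler_nat.
Qed.

Lemma tower_measure_initial n i : (i <= nlevel n)%N ->
  mu (initial n i) = (i%:R / (slices t n)%:R)%:E.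
Proof.
move=> lei; rewrite /tower_measure /mrestr (setIidl (initial_space lei)).
rewrite lebesgue_measure_itv /= lte_fin; case: ifP => [_|].
  by rewrite oppr0 adde0.
move=> /negbT; rewrite -leNgt => le0; congr (_%:E).
by apply/esym/eqP; rewrite eq_le le0 divr_ge0.
Qed.

Lemma tower_measure_unit : mu `[0, 1[%classic = 1%E.
Proof.
rewrite -(initial_slices 0) tower_measure_initial ?leq_slices_level//.
by rewrite divff// slicesR_neq0.
Qed.

Section Invariant.
Variable B : set R.
Hypothesis mB : measurable B.
Hypothesis invB : forall g, transport t g @^-1` B = B.

Let d : R := fine (mu (B `&` `[0, 1[%classic)).

Let dE : mu (B `&` `[0, 1[%classic) = d%:E.
Proof.
rewrite fineK// ge0_fin_numE ?measure_ge0//.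
apply: (@tower_measure_fin _ _ _ _ 1).
  by apply: measurableI => //; exact: measurable_itv.
by move=> x [_]; rewrite /= !in_itv /= => /andP[].
Qed.

Let density_initial n i : (i <= nlevel n)%N ->
  mu (initial n i `&` B) = (d%:E * mu (initial n i))%E.
Proof.
move=> lei; rewrite setIC tower_measure_initial// invariant_initial//.
have := invariant_initial mB invB (leq_slices_level t n).
rewrite initial_slices dE.
have : mu (B `&` cell n 0) \is a fin_num.
  rewrite ge0_fin_numE ?measure_ge0//.
  apply: (@le_lt_trans _ _ (mu (cell n 0))).
    apply: le_measure; rewrite ?inE; [|exact: measurable_cell|exact: subIsetr].
    by apply: measurableI => //; exact: measurable_cell.
  by apply: le_lt_trans (tower_measure_cell _ _) _; rewrite ltry.
case: (mu _) => // a _; rewrite -!EFinM => -[->]; congr (_%:E).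
by field; exact: slicesR_neq0.
Qed.

Let block (x : R) n := initial n (minn (rung t n x) (nlevel n)).

Let bigcup_block x : \bigcup_n block x n = `]-oo, x[ `&` D.
Proof.
apply/seteqP; split=> y.
  move=> [n _ yb]; split; last by apply: initial_space yb; rewrite geq_minr.
  move: yb; rewrite /block /initial /= !in_itv /= => /andP[y0 lty].
  apply: (lt_le_trans lty); rewrite ler_pdivrMr ?slicesR_gt0//.
  have x0 : 0 <= x.
    have : 0 < (minn (rung t n x) (nlevel n))%:R / (slices t n)%:R :> R.
      exact: le_lt_trans lty.
    rewrite pmulr_lgt0 ?invr_gt0 ?slicesR_gt0// ltr0n leq_min => /andP[+ _].
    rewrite /rung truncn_gt0 => le1.
    rewrite -(pmulr_lge0 _ (slicesR_gt0 R t n)).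
    exact: le_trans le1.
  apply: (@le_trans _ _ (rung t n x)%:R); first by rewrite ler_nat geq_minl.
  by have /andP[] := rung_itv t n x0.
move=> [/=]; rewrite in_itv /= => ltyx [n0 yn0].
have y0 : 0 <= y by have /andP[] := yn0.
(* From this stage on, cells are shorter than the gap between [y] and [x]. *)
pose m := Num.truncn (x - y)^-1; pose n := maxn n0 m.
exists n => //; have yn : stage t n y by apply: stage_le yn0; exact: leq_maxl.
have gap : 1 <= (x - y) * (slices t n)%:R.
  rewrite -ler_pdivrMl ?subr_gt0// mulr1.
  apply/ltW/(lt_le_trans (truncnS_gt _)).
  by rewrite ler_nat; apply: leq_ltn_trans (slices_gt t n); exact: leq_maxr.
have /andP[ley lty] := rung_itv t n y0.
rewrite /block /initial /= in_itv /= y0 ltr_pdivlMr ?slicesR_gt0//.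
apply: (lt_le_trans lty); rewrite ler_nat leq_min.
have /andP[_ ->] := yn; rewrite andbT /rung truncn_ge_nat; last first.
  by rewrite mulr_ge0// (le_trans y0)// ltW.
rewrite -natr1; lra.
Qed.

Let nondecreasing_block x : nondecreasing_seq (block x).
Proof.
apply/nondecreasing_seqP => n; apply/subsetPset => y.
rewrite /block /initial /= !in_itv /= => /andP[-> /=]; move/lt_le_trans; apply.
rewrite ler_pdivrMr ?slicesR_gt0// mulrAC ler_pdivlMr ?slicesR_gt0//.
rewrite slicesS natrM mulrCA [leRHS]mulrC ler_pM2l ?slicesR_gt0//.
rewrite -natrM ler_nat leq_min; apply/andP; split; last first.
  apply: (@leq_trans (nlevel n * size (cuts t n))).
    by rewrite leq_mul2r geq_minr orbT.
  by rewrite levelS size_cat size_allpairs leq_addr.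
have [x0|x0] := leP 0 x.
  rewrite (rungS t n x0); apply: leq_trans (leq_divM _ (size (cuts t n))).
  by rewrite leq_mul2r geq_minl orbT.
have -> : rung t n x = 0%N.
  apply/eqP; rewrite -leqn0 leqNgt truncn_gt0 -ltNge (lt_trans _ ltr01)//.
  by rewrite nmulr_rlt0// slicesR_gt0.
by rewrite min0n mul0n.
Qed.

Let measurable_block x n : measurable (block x n).
Proof. exact: measurable_itv. Qed.

Let density_ray x :
  mu (`]-oo, x[%classic `&` B) = (d%:E * mu (`]-oo, x[%classic))%E.
Proof.
have mblock n : measurable (block x n : set (measurableTypeR R)).
  exact: measurable_block.
have mray : measurable (\bigcup_n block x n) by exact: bigcupT_measurable.
have d0 : (0 <= d%:E)%E by rewrite -dE measure_ge0.
pose m1 : {measure set (measurableTypeR R) -> \bar R} := mrestr mu mB.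
pose m2 : {measure set (measurableTypeR R) -> \bar R} :=
  mscale (NngNum d0) mu.
have muD E : mu (E `&` D) = mu E.
  by rewrite /tower_measure /mrestr -setIA setIid.
suff : mu ((\bigcup_n block x n) `&` B) = (d%:E * mu (\bigcup_n block x n))%E.
  by rewrite bigcup_block setIAC !muD.
change (m1 (\bigcup_n block x n) = m2 (\bigcup_n block x n)).
have cvg1 := nondecreasing_cvg_mu (mu := m1) mblock mray
  (@nondecreasing_block x).
have cvg2 := nondecreasing_cvg_mu (mu := m2) mblock mray
  (@nondecreasing_block x).
rewrite -(cvg_lim _ cvg1)// -(cvg_lim _ cvg2)//; apply/congr_lim/funext => n /=.
by rewrite /m1 /m2 /mscale /= /mrestr density_initial// geq_minr.
Qed.

(** As functions of [E], both sides are measures, so they need only be compared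
on half-lines.  There they agree because cells of one stage carry equal masses
of [B], and a half-line is, up to null sets, an increasing union of initial
blocks of cells. *)
Lemma invariant_density (E : set R) : measurable E ->
  mu (E `&` B) = (mu (B `&` `[0%R, 1%R[%classic) * mu E)%E.
Proof.
move=> mE; rewrite dE.
have d0 : 0 <= d by rewrite -lee_fin -dE measure_ge0.
pose m1 : {measure set (measurableTypeR R) -> \bar R} := mrestr mu mB.
pose m2 : {measure set (measurableTypeR R) -> \bar R} :=
  mscale (NngNum d0) mu.
change (m1 E = m2 E).
refine (@measure_unique _ R (measurableTypeR R) (@RGenInftyO.G R)
  (fun n => `]-oo, n%:R[%classic) _ _ _ _ m1 m2 _ _ E mE).
- exact: RGenInftyO.measurableE.
- move=> _ _ [x ->] [y ->]; exists (Num.min x y).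
  by apply/seteqP; split=> z; rewrite /= !in_itv /= lt_min => /andP.
- by move=> n; exists n%:R.
- apply/seteqP; split=> // x _; exists (Num.truncn x).+1 => //=.
  by rewrite in_itv /= truncnS_gt.
- by move=> _ [x ->]; exact: density_ray.
- move=> n; apply: (@tower_measure_fin _ _ _ _ n%:R); last exact: subIsetl.
  by apply: measurableI => //; exact: measurable_itv.
Qed.

End Invariant.

(** The density formula applied to the complement of [B] shows that the density
of [B] vanishes or its complement is null. *)
Lemma transport_ergodic : ergodic mu (transport t).
Proof.
move=> B mB invB.
have := invariant_density mB invB (measurableC mB).
rewrite setICl measure0 => /esym/eqP; rewrite mule_eq0.
move=> /orP[/eqP d0|/eqP BC0].
  left; have := invariant_density mB invB mB.
  by rewrite d0 mul0e setIid.
right; exact: BC0.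
Qed.

(** For every [n] an atom lies, up to a null set, in one cell of stage [n], and
the lengths of the cells tend to zero. *)
Lemma tower_measure_non_atomic : non_atomic mu.
Proof.
move=> B [mB B0 atB].
have mBI n j : measurable (B `&` cell n j : set (measurableTypeR R)).
  by apply: measurableI => //; exact: measurable_cell.
have le_inv n : (mu B <= ((slices t n)%:R^-1)%:E)%E.
  have [j Bj] : exists j, mu (B `&` cell n j) <> 0%E.
    apply/existsNP => Bnull; move: B0; apply/negP; rewrite -leNgt.
    apply: (@le_trans _ _ (mu (\bigcup_j (B `&` cell n j)))).
      rewrite -setI_bigcupr /tower_measure /mrestr.
      apply: (@le_measure _ _ _ leb).
      - by rewrite inE; apply: measurableI => //; exact: measurable_tower_space.
      - rewrite inE; apply: measurableI; last exact: measurable_tower_space.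
        apply: measurableI => //; apply: bigcupT_measurable => j.
        exact: measurable_cell.
      - move=> x [Bx Dx]; split=> //; split=> //; exists (rung t n x) => //.
        by apply/cellP; have [m /andP[x0 _]] := Dx.
    apply: (le_trans (le_mu_bigcup mu (mBI n) _)).
      exact: bigcupT_measurable.
    by rewrite eseries0// => j _ _; exact: Bnull.
  have [//|BDj] := atB _ (mBI n j) (@subIsetl _ _ _).
  apply: le_trans (tower_measure_cell n j).
  apply: (@le_trans _ _ (mu (B `&` cell n j) + mu (B `\` (B `&` cell n j)))%E).
    rewrite -measureU//; last 2 first.
    - exact: measurableD.
    - by apply/seteqP; split=> // x [Bc [_ nBc]].
    by rewrite setDUK//; exact: subIsetl.
  rewrite BDj adde0; apply: le_measure; rewrite ?inE//.
  exact: measurable_cell.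
move: B0; apply/negP; rewrite -leNgt; apply/lee_addgt0Pr => e e0.
rewrite add0e; apply: le_trans (le_inv (Num.truncn e^-1)) _.
rewrite lee_fin -[leRHS]invrK lef_pV2 ?posrE ?slicesR_gt0 ?invr_gt0//.
apply/ltW/(lt_le_trans (truncnS_gt _)); rewrite ler_nat.
exact: slices_gt.
Qed.

End TowerErgodicity.

(** * Orbits with oscillating ratios *)

Lemma orbit_sum_indic (R : realType) (G : groupType) (X : Type)
    (T : G -> X -> X) (F : {fset G}) (B : set X) (x : X) :
  orbit_sum T F (\1_B : X -> R) x = (count (fun g => `[< B (T g x) >]) F)%:R.
Proof.
rewrite /orbit_sum -sum1_count natr_sum [RHS]big_mkcond.
apply: eq_bigr => g _; rewrite indicE; case: (boolP `[< _ >]) => [/asboolP BT|].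
  by rewrite mem_set.
by move=> /asboolP nBT; rewrite memNset.
Qed.

Lemma integrable_indic_fin d (X : measurableType d) (R : realType)
    (mu : {measure set X -> \bar R}) (B : set X) :
    measurable B -> (mu B < +oo)%E ->
  mu.-integrable [set: X] (EFin \o (\1_B : X -> R)).
Proof.
move=> mB Boo; apply/integrableP; split; first exact/measurable_EFinP.
rewrite (eq_integral (fun x => (\1_B x)%:E)); last first.
  by move=> x _; rewrite gee0_abs// lee_fin.
by rewrite integral_indic// setIT.
Qed.

Lemma Rintegral_indic d (X : measurableType d) (R : realType)
    (mu : {measure set X -> \bar R}) (B : set X) :
  measurable B -> \int[mu]_x (\1_B x : R) = fine (mu B).
Proof. by move=> mB; rewrite /Rintegral integral_indic// setIT. Qed.

Section LabelledSets.
Variables (R : realType) (G : groupType) (t : tower G).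
Local Notation mu := (@tower_measure R G t).

Definition labelled m (u : seq G) : set R :=
  [set x | stage t m x /\ label t m x \in u].

Lemma labelled_cons m v u :
  labelled m (v :: u) = labelled m [:: v] `|` labelled m u.
Proof.
apply/seteqP; split=> x; rewrite /labelled /= !inE.
  by move=> [xm /orP[xv|xu]]; [left|right].
by case=> -[-> ->]; rewrite ?orbT.
Qed.

Lemma labelled1 m v : labelled m [:: v] =
  if v \in level t m then @tower_cell R G t m (index v (level t m)) else set0.
Proof.
case: ifPn => [vm|nvm]; apply/seteqP; split=> // x.
- move=> [xm]; rewrite inE => /eqP<-; apply/cellP; rewrite index_label//.
  by have /andP[] := xm.
- move=> /cellP[x0 rx]; have xm : stage t m x by rewrite /stage x0 rx index_mem.
  by split=> //; rewrite inE /label rx nth_index.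
- by move=> [/mem_label xm]; rewrite inE => /eqP xv; rewrite -xv xm in nvm.
Qed.

Lemma measurable_labelled m u :
  measurable (labelled m u : set (measurableTypeR R)).
Proof.
elim: u => [|v u IHu].
  rewrite (_ : labelled _ _ = set0); first exact: measurable0.
  by apply/seteqP; split=> // x [].
rewrite labelled_cons; apply: measurableU => //.
rewrite labelled1.
by case: ifP => _; [exact: measurable_cell|exact: measurable0].
Qed.

Lemma tower_measure_labelled m u :
  (mu (labelled m u) <= ((size u)%:R / (slices t m)%:R)%:E)%E.
Proof.
elim: u => [|v u IHu].
  rewrite (_ : labelled _ _ = set0) ?measure0 ?mul0r//.
  by apply/seteqP; split=> // x [].
rewrite labelled_cons.
apply: (le_trans (measureU2 _ (measurable_labelled _ _)
  (measurable_labelled _ _))).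
rewrite -nat1r mulrDl mul1r EFinD; apply: leeD => //.
rewrite labelled1; case: ifP => _; first exact: tower_measure_cell.
by rewrite measure0 lee_fin.
Qed.

Lemma unit_stage m (x : R) : `[0, 1[%classic x -> stage t m x.
Proof.
rewrite /= in_itv /= => /andP[x0 x1]; rewrite /stage x0.
apply: leq_trans (leq_slices_level t m).
by rewrite /rung truncn_lt_nat ?mulr_ge0// gtr_pMl ?slicesR_gt0.
Qed.

Lemma unit_label m (x : R) : stage t m x ->
  `[0, 1[%classic x <-> label t m x \in take (slices t m) (level t m).
Proof.
move=> xm; have /andP[x0 _] := xm.
rewrite in_take ?mem_label// index_label// /rung truncn_lt_nat ?mulr_ge0//.
by rewrite /= in_itv /= x0 gtr_pMl ?slicesR_gt0.
Qed.

End LabelledSets.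

Section ErraticOrbits.
Variables (R : realType) (G : groupType) (A : {fset G}) (n : nat -> nat).
Local Notation B := (word_ball A).
Variable t : tower G.
Hypothesis t_size : forall N, size (cuts t N) = (2 ^ N.+2)%N.
Hypothesis t_sub : forall N, {subset level t N <= level t N.+1}.
Hypothesis t_erratic : forall N,
  erratic_cuts A n N (level t N) (cuts t N) (level t N.+1).
Local Notation mu := (@tower_measure R G t).
Local Notation U := (`[0, 1[%classic : set R).

(** [take (slices t N) (level t N)] lists the labels at stage [N] of the cells
contained in the unit interval; the bait carries the same labels one stage
later, on cells that are [size (cuts t N)] times shorter. *)
Definition bait : set R :=
  \bigcup_N labelled t N.+1 (take (slices t N) (level t N)).

Lemma measurable_bait : measurable bait.
Proof. by apply: bigcupT_measurable => N; exact: measurable_labelled. Qed.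

Lemma tower_measure_bait : (mu bait <= (2^-1)%:E)%E.
Proof.
apply: (@le_trans _ _ (\sum_(N <oo)
    mu (labelled t N.+1 (take (slices t N) (level t N))))%E).
  apply: le_mu_bigcup; last exact: measurable_bait.
  by move=> N; exact: measurable_labelled.
have half0 : 0 <= 2^-1 :> R by [].
apply: le_trans (epsilon_trick0 xpredT half0).
apply: lee_nneseries => // N _.
apply: (le_trans (@tower_measure_labelled R G t _ _)).
rewrite lee_fin size_takel ?leq_slices_level// slicesS t_size natrM invfM mulrA.
by rewrite mulfV ?slicesR_neq0// mul1r expnS natrM invfM.
Qed.

(** At stage [N.+1] a point of the unit interval carries a label [f * c].  The
ball of radius [n i] attached to [c] moves it to all labels in
[take (slices t N) (level t N)], which are bait.  Within the unit interval it
only reaches labels [f' * c] with [f'] in the same list, because it reaches no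
other cut. *)
Lemma erratic_orbit N (x : R) : U x -> exists i, [/\ (N <= i)%N,
  orbit_sum (transport t) (B (n i)) (\1_U : R -> R) x != 0 &
  1 <= orbit_ratio (transport t) (B (n i)) (\1_bait : R -> R) \1_U x].
Proof.
move=> Ux; have xN := unit_stage t N Ux; have [xN1 lbl] := stageS xN.
have [i [leNi near far absorb]] := t_erratic (mem_cut_of t N x).
set f := label t N x in lbl; set c := cut_of t N x in lbl near far absorb.
have fN : f \in level t N := mem_label xN.
pose first := take (slices t N) (level t N).
have firstN h : h \in first -> h \in level t N by exact: mem_take.
have size_first : size first = slices t N.
  by rewrite size_takel// leq_slices_level.
have uniq_first : uniq first by rewrite take_uniq// level_uniq.
have many_bait : (slices t N
    <= count (fun g => `[< bait (transport t g x) >]) (B (n i)))%N.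
  rewrite -size_first -(size_map (fun h => (h * (f * c)^-1)%g)) -size_filter.
  apply: uniq_leq_size; first by rewrite map_inj_uniq//; exact: mulIg.
  move=> _ /mapP[h hfirst ->].
  rewrite mem_filter; apply/andP; split; last first.
    by apply: near => //; exact: firstN.
  set g := (_ * _)%g; have gx : (g * label t N.+1 x)%g = h.
    by rewrite lbl mulgVK.
  have dg : defined t N.+1 g x.
    by rewrite /defined xN1 gx; exact/t_sub/firstN.
  apply/asboolP; exists N => //; have [yN1 lbly] := label_transport dg.
  by split=> //; rewrite lbly gx.
have few_unit : (count (fun g => `[< U (transport t g x) >]) (B (n i))
    <= slices t N)%N.
  rewrite -size_first -(size_map (fun h => (h * c * (f * c)^-1)%g)).
  rewrite -size_filter.
  apply: uniq_leq_size; first by rewrite filter_uniq// fset_uniq.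
  move=> g; rewrite mem_filter => /andP[/asboolP Uy gB].
  set y := transport t g x.
  have dg : defined t N.+1 g x by rewrite /defined xN1 lbl absorb.
  have [yN1 ylbl] := label_transport dg; have yN := unit_stage t N Uy.
  have [_ ylblS] := stageS yN; rewrite -/y in ylbl.
  have yE : (g * (f * c))%g = (label t N y * cut_of t N y)%g.
    by rewrite -lbl -ylbl -ylblS.
  have gE : g = (label t N y * cut_of t N y * (f * c)^-1)%g.
    by rewrite -yE mulgK.
  have yc : cut_of t N y = c.
    by apply: (far f (label t N y)) => //; rewrite ?mem_cut_of ?mem_label// -gE.
  apply/mapP; exists (label t N y); first exact/unit_label.
  by rewrite gE yc.
have some_unit : (0 < count (fun g => `[< U (transport t g x) >]) (B (n i)))%N.
  rewrite -has_count; apply/hasP; exists 1%g; first exact: mem1_word_ball.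
  by apply/asboolP; rewrite transport1.
exists i; split=> //.
  by rewrite orbit_sum_indic pnatr_eq0 -lt0n.
rewrite /orbit_ratio !orbit_sum_indic ler_pdivlMr ?ltr0n// mul1r ler_nat.
exact: leq_trans few_unit many_bait.
Qed.

End ErraticOrbits.

Theorem theorem1p3 (R : realType) (G : groupType) (A : {fset G})
  (symA : symmetric_fset A) (genA : generates A)
  (not_besicovitch : forall n : nat -> nat, subsequence_index n ->
    ~ besicovitch (fun i => word_ball A (n i))) :
  forall n : nat -> nat, subsequence_index n ->
    ~ ratio_ergodic_theorem R (fun i => word_ball A (n i)).
Proof.
move=> n n_sub ret.
have [t tP] := erratic_tower symA genA not_besicovitch n_sub.
have t_size N : size (cuts t N) = (2 ^ N.+2)%N by have [] := tP N.
have t_sub N : {subset level t N <= level t N.+1} by have [] := tP N.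
have t_erratic N : erratic_cuts A n N (level t N) (cuts t N) (level t N.+1).
  by have [] := tP N.
pose mu : {sigma_finite_measure set (measurableTypeR R) -> \bar R} :=
  @tower_measure R G t.
pose U : set (measurableTypeR R) := `[0, 1[%classic.
pose S : set (measurableTypeR R) := @bait R G t.
have mU : measurable U by exact: measurable_itv.
have mS : measurable S by exact: measurable_bait.
have muU : mu U = 1%E := @tower_measure_unit R G t.
have muS : (mu S <= (2^-1)%:E)%E := @tower_measure_bait R G t t_size.
have Uoo : (mu U < +oo)%E by rewrite muU ltry.
have Soo : (mu S < +oo)%E by rewrite (le_lt_trans muS)// ltry.
have intU : \int[mu]_x (\1_U x : R) = 1.
  by transitivity (fine (mu U)); [exact: Rintegral_indic|rewrite muU].
have intS : \int[mu]_x (\1_S x : R) <= 2^-1.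
  have -> : \int[mu]_x (\1_S x : R) = fine (mu S) by exact: Rintegral_indic.
  rewrite -lee_fin fineK; first exact: muS.
  by rewrite ge0_fin_numE ?measure_ge0//.
have [|||V [mV V0 subV]] := ret _ _ mu (transport t) (@transport_action R G t)
  (@transport_ergodic R G t) (@tower_measure_non_atomic R G t) \1_S \1_U.
- exact: integrable_indic_fin mS Soo.
- exact: integrable_indic_fin mU Uoo.
- by rewrite intU oner_eq0.
have [x [Ux nVx]] : exists x, U x /\ ~ V x.
  apply: contrapT => UV; have : (mu U <= mu V)%E.
    apply: le_measure; rewrite ?inE// => x Ux.
    by apply: contrapT => nVx; apply: UV; exists x.
  by rewrite muU V0 leNgt lte01.
have lim_lt1 : \int[mu]_x (\1_S x : R) / \int[mu]_x (\1_U x : R) < 1.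
  by rewrite intU divr1 (le_lt_trans intS)// invf_lt1// ltr1n.
have cvgx : orbit_ratio (transport t) (word_ball A (n i)) (\1_S : R -> R) \1_U x
    @[i --> within [set i | orbit_sum (transport t) (word_ball A (n i))
                              (\1_U : R -> R) x != 0] \oo]
    --> \int[mu]_x (\1_S x : R) / \int[mu]_x (\1_U x : R).
  by apply: contrapT => ncvg; exact/nVx/subV.
have [N _ near_lt1] := cvgx _ (lt_nbhsl lim_lt1).
have [i [leNi unit_ne0 ratio_ge1]] := erratic_orbit t_sub t_erratic N Ux.
by have := near_lt1 i leNi unit_ne0; rewrite /= ltNge ratio_ge1.
Qed.
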